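(* Let $n=2m>3$ be an even integer. Every $n$-polygon with $m$ axes is determined by two sides $a,b\in\mathbb{N}$ with $1\le a<b\le n-1$, its sequence of $n$ sides being the alternating sequence $(a,b,a,b,\ldots,a,b)$ (up to cyclic rotation of the sequence).
   Context: Fix $n\ge 3$ and the vertices $v_k=e^{2\pi i k/n}$, $k=0,\ldots,n-1$, on the unit circle. An $n$-polygon is a Hamiltonian cycle through these vertices: a closed path $v_{\sigma_1}v_{\sigma_2}\cdots v_{\sigma_n}v_{\sigma_1}$ of straight segments with $(\sigma_1,\ldots,\sigma_n)$ an ordering of $0,\ldots,n-1$. Its sides are the integers $e_i\in\{1,\ldots,n-1\}$ with $e_i\equiv\sigma_{i+1}-\sigma_i\pmod n$ ($\sigma_{n+1}=\sigma_1$), and the polygon is described by its cyclic sequence of sides $(e_1,\ldots,e_n)$. An $n$-polygon with $m$ axes is one with exactly $m$ axes of reflection symmetry.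
   Formalization: The case n=4 is excluded, because the claim fails there: the bow-tie v0 v1 v3 v2 has exactly 2=m axes but sides (1,2,3,2), and every 4-polygon with exactly 2 axes is such a bow-tie. *)

(* Defs.v *)
(* The plane is identified with the complex numbers R[i]. *)
From mathcomp Require Import all_boot all_order all_algebra perm.
From mathcomp Require Import all_classical all_reals all_analysis.
From mathcomp Require Import complex.

Set Implicit Arguments.
Unset Strict Implicit.
Unset Printing Implicit Defensive.

Import Order.TTheory GRing.Theory Num.Theory.
Import numFieldNormedType.Exports.

Local Open Scope classical_set_scope.
Local Open Scope ring_scope.
Local Open Scope complex_scope.

Section Plane.
Variable R : realType.

(* v_k = e^(2 pi i k / n) *)
Definition vertex (n k : nat) : R[i] :=
  let t : R := 2 * pi * k%:R / n%:R in cos t +i* sin t.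

Definition line (p u : R[i]) : set (R[i]) :=
  [set p + t%:C * u | t in [set: R]].

(* For u != 0, the number u / u^* has modulus 1 and this map fixes exactly the
   points z such that z - p is a real multiple of u. *)
Definition reflection (p u z : R[i]) : R[i] :=
  p + u / Num.conj u * Num.conj (z - p).

(* A straight segment is recorded by the set of its two end points. *)
Definition map_segments (f : R[i] -> R[i]) (E : set (set (R[i]))) :
    set (set (R[i])) := [set f @` s | s in E].

(* [ordS] is the successor modulo n, so the last vertex is joined to the first. *)
Definition polygon (n : nat) (sigma : {perm 'I_n}) : set (set (R[i])) :=
  [set [set vertex n (sigma i); vertex n (sigma (ordS i))] | i in [set: 'I_n]].

Definition axis (n : nat) (sigma : {perm 'I_n}) : set (set (R[i])) :=
  [set L | exists p u : R[i], [/\ u != 0, L = line p u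
    & map_segments (reflection p u) (polygon sigma) = polygon sigma]].

Definition has_axes (n : nat) (sigma : {perm 'I_n}) (m : nat) : Prop :=
  (axis sigma #= `I_m)%card.

End Plane.

Arguments polygon R {n} sigma _.
Arguments axis R {n} sigma _.

(* The representative in {0, .., n-1} of sigma (i+1) - sigma i modulo n; it is
   nonzero as soon as n > 1. *)
Definition side (n : nat) (sigma : {perm 'I_n}) (i : 'I_n) : nat :=
  ((sigma (ordS i) + (n - sigma i)) %% n)%N.

Definition sides (n : nat) (sigma : {perm 'I_n}) : seq nat :=
  [seq side sigma i | i <- enum 'I_n].

Definition alternating (m a b : nat) : seq nat :=
  flatten (nseq m [:: a; b]).

Definition alternating_sides (n : nat) (sigma : {perm 'I_n}) (m a b : nat) :
    Prop := exists k : nat, sides sigma = rot k (alternating m a b).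

(* Main.v *)
(* A symmetry in a line permutes the vertices, so it fixes their centroid 0 and
   is z |-> v_c z^* for some c modulo n; distinct c give distinct axes. With m
   axes, two of the m residues c differ by 1 or 2, hence the rotation k |-> k + 2
   preserves the polygon. Along the polygon it acts as a translation
   i |-> i + t or as i |-> t - i; the latter is an involution, impossible for
   n > 4. As that translation has order m, gcd(t, n) divides 2, and the sides are
   2-periodic. They are not constant, because a regular (star) polygon has n
   axes. *)
Require Import Defs.
From mathcomp Require Import all_boot all_order all_algebra perm.
From mathcomp Require Import all_classical all_reals all_analysis.
From mathcomp Require Import complex.
From mathcomp Require Import ring lra zify.

Set Implicit Arguments.
Unset Strict Implicit.
Unset Printing Implicit Defensive.

Import Order.TTheory GRing.Theory Num.Theory.
Local Open Scope ring_scope.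

(** * The vertices as roots of unity *)

Section Vertices.
Variable R : realType.

Lemma conj_complex (a b : R) : Num.conj (Complex a b) = Complex a (- b).
Proof. by []. Qed.

Lemma vertexD (n j k : nat) : vertex R n (j + k) = vertex R n j * vertex R n k.
Proof.
rewrite /vertex natrD mulrDr mulrDl cosD sinD; simpc.
by congr (Complex _ _); rewrite addrC mulrC.
Qed.

Lemma vertex0 (n : nat) : vertex R n 0 = 1.
Proof. by rewrite /vertex mulr0 mul0r cos0 sin0. Qed.

Lemma vertex_full (n : nat) : (0 < n)%N -> vertex R n n = 1.
Proof.
move=> n0; rewrite /vertex mulfK ?pnatr_eq0 -?lt0n//.
by rewrite mulr_natl cos2pi sin2pi.
Qed.

Lemma vertexM (n j k : nat) : vertex R n (j * k) = vertex R n j ^+ k.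
Proof. by elim: k => [|k IH]; rewrite ?muln0 ?vertex0// mulnS vertexD IH exprS. Qed.

Lemma vertex_mod (n k : nat) : (0 < n)%N -> vertex R n (k %% n) = vertex R n k.
Proof.
move=> n0; rewrite [in RHS](divn_eq k n) vertexD mulnC vertexM.
by rewrite vertex_full// expr1n mul1r.
Qed.

Lemma vertex_conj (n k : nat) : vertex R n k * Num.conj (vertex R n k) = 1.
Proof.
rewrite /vertex conj_complex; simpc; rewrite -!expr2 cos2Dsin2.
by congr (Complex _ _); ring.
Qed.

Lemma vertex_neq0 (n k : nat) : vertex R n k != 0.
Proof.
apply/eqP => v0; have := vertex_conj n k.
by rewrite v0 mul0r => /esym/eqP; rewrite oner_eq0.
Qed.

Lemma vertex_norm (n k : nat) : `|vertex R n k| = 1.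
Proof.
have : `|vertex R n k| ^+ 2 = 1 by rewrite normCK vertex_conj.
by move/eqP; rewrite sqrp_eq1// => /eqP.
Qed.

(** With [t] half the angle, [0 < t < pi], so [sin t > 0] and the real part [1 - 2 sin^2 t] falls
    below 1. *)
Lemma vertex_neq1 (n k : nat) : (0 < k < n)%N -> vertex R n k != 1.
Proof.
move=> /andP[k0 kn]; apply/negP => /eqP; rewrite /vertex => -[+ _].
pose t : R := pi * k%:R / n%:R.
have -> : 2 * pi * k%:R / n%:R = t *+ 2 :> R by rewrite /t; ring.
rewrite cos_mulr2n cos2sin2.
have : 0 < sin t.
  have n0 : 0 < n%:R :> R by rewrite ltr0n (leq_ltn_trans _ kn).
  apply: sin_gt0_pi; rewrite /t divr_gt0 ?mulr_gt0 ?pi_gt0//= ?ltr0n//.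
  by rewrite ltr_pdivrMr// ltr_pM2l ?pi_gt0// ltr_nat.
by move=> ?; nra.
Qed.

Lemma vertex_inj (n : nat) : injective (fun i : 'I_n => vertex R n i).
Proof.
suff le i j : (i < n)%N -> (j < n)%N -> (i <= j)%N ->
    vertex R n i = vertex R n j -> i = j.
  move=> i j /= e; apply: val_inj => /=; case: (leqP i j) => ij; first exact: le.
  by apply/esym/le => //; exact: ltnW.
move=> iN jN ij; rewrite -(subnKC ij) vertexD -[LHS]mulr1.
move/(mulfI (vertex_neq0 _ _))/esym/eqP => e.
have [->|] := posnP (j - i)%N; first by rewrite addn0.
by move=> d0; move: e; apply: contraTeq => _; apply: vertex_neq1; lia.
Qed.

(** Geometric sum: multiplied by [w - 1] it becomes [w ^+ n - 1 = 0]. *)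
Lemma vertex_sum0 (n : nat) : (1 < n)%N -> \sum_(i < n) vertex R n i = 0.
Proof.
move=> n1; set w := vertex R n 1.
have w1 : w - 1 != 0 by rewrite subr_eq0 vertex_neq1.
apply: (mulfI w1); rewrite mulr0.
rewrite (eq_bigr (fun i : 'I_n => w ^+ i)) => [|i _]; last first.
  by rewrite -vertexM mul1n.
by rewrite -subrX1 -vertexM mul1n vertex_full ?subrr//; lia.
Qed.

(* A square root of [vertex n k], spanning the axis of z |-> vertex n k * z^*. *)
Lemma vertex_half (n k : nat) : vertex R (n + n) k ^+ 2 = vertex R n k.
Proof.
rewrite -vertexM /vertex.
have -> // : 2 * pi * (k * 2)%:R / (n + n)%:R = 2 * pi * k%:R / n%:R :> R.
rewrite natrM natrD; have [->|n0] := eqVneq (n%:R : R) 0.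
  by rewrite addr0 invr0 !mulr0.
by field; rewrite n0 -mulr2n mulrn_eq0.
Qed.

Lemma vertexDz (n : nat) (i j : 'I_n.+2) :
  vertex R n.+2 (i + j)%R = vertex R n.+2 i * vertex R n.+2 j.
Proof. by rewrite /= vertex_mod// vertexD. Qed.

Lemma vertexBz (n : nat) (i j : 'I_n.+2) :
  vertex R n.+2 (i - j)%R = vertex R n.+2 i * Num.conj (vertex R n.+2 j).
Proof.
apply: (mulIf (vertex_neq0 n.+2 j)); rewrite -vertexDz subrK.
by rewrite -mulrA [Num.conj _ * _]mulrC vertex_conj mulr1.
Qed.

End Vertices.

(** * Adjacency and symmetries in terms of residues *)

Definition adjacent (n : nat) (s : {perm 'I_n.+2}) (x y : 'I_n.+2) : bool :=
  (y == s (s^-1%g x + 1)) || (x == s (s^-1%g y + 1)).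

(** The map [c - x] is the trace on vertex indices of conjugation followed by multiplication by v_c.
    One implication suffices, as this map is an involution. *)
Definition reflections (n : nat) (s : {perm 'I_n.+2}) : {set 'I_n.+2} :=
  [set c | [forall x, forall y,
     adjacent s x y ==> adjacent s (c - x) (c - y)]].

Definition preserves (n : nat) (s : {perm 'I_n.+2}) (f : 'I_n.+2 -> 'I_n.+2) :=
  forall x y, adjacent s x y -> adjacent s (f x) (f y).

Lemma reflectionsP (n : nat) (s : {perm 'I_n.+2}) (c : 'I_n.+2) :
  reflect (preserves s (fun x => c - x)) (c \in reflections s).
Proof.
rewrite inE; apply: (iffP forallP) => [h x y xy|h x].
  by move/forallP/(_ y)/implyP: (h x); exact.
by apply/forallP => y; apply/implyP; exact: h.
Qed.

Lemma ordS_Zp (n : nat) (i : 'I_n.+2) : ordS i = i + 1.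
Proof. by apply: val_inj; rewrite /= modnDmr addn1. Qed.

Lemma side_Zp (n : nat) (s : {perm 'I_n.+2}) (i : 'I_n.+2) :
  side s i = (s (i + 1) - s i)%R.
Proof. by rewrite /side ordS_Zp /= modnDmr. Qed.

Lemma natZp_eq0 (n k : nat) : (k%:R == 0 :> 'I_n.+2) = (n.+2 %| k)%N.
Proof. by rewrite -(inj_eq val_inj) /= Zp_nat /= /dvdn. Qed.

Lemma adjacentE (n : nat) (s : {perm 'I_n.+2}) (i j : 'I_n.+2) :
  adjacent s (s i) (s j) = (j == i + 1) || (i == j + 1).
Proof. by rewrite /adjacent !permK !(inj_eq perm_inj). Qed.

Lemma adjacent_next (n : nat) (s : {perm 'I_n.+2}) (i : 'I_n.+2) :
  adjacent s (s i) (s (i + 1)).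
Proof. by rewrite adjacentE eqxx. Qed.

(** Two reflections compose to a rotation: [c - (d - x) = x + (c - d)]. *)
Lemma preserves_rotation (n : nat) (s : {perm 'I_n.+2}) (c d : 'I_n.+2) :
  c \in reflections s -> d \in reflections s ->
  preserves s (fun x => x + (c - d)).
Proof.
move=> /reflectionsP hc /reflectionsP hd x y /hd/hc.
by rewrite !opprB !addrA ![c + _]addrC ![x + _ - _]addrAC -!addrA.
Qed.

(* Otherwise the translates of the set of reflections by 0, 1 and 2 would be
   disjoint. *)
Lemma preserves_add2 (n m : nat) (s : {perm 'I_n.+2}) :
  n.+2 = (2 * m)%N -> (m <= #|reflections s|)%N ->
  preserves s (fun x => x + 2).
Proof.
set S := reflections s => nE mS.
have rot c d k : c \in S -> d \in S -> c = d + k -> preserves s (fun x => x + k).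
  move=> cS dS e x y xy; have := preserves_rotation cS dS xy.
  by rewrite e [d + k]addrC addrK.
pose T k : {set 'I_n.+2} := [set x + k | x in S].
have TE k : #|T k| = #|S| by rewrite card_imset//; exact: addIr.
have [/existsP[c /existsP[d /and3P[cS dS /eqP e]]]|no1] :=
    boolP [exists c, exists d, [&& c \in S, d \in S & c == d + 1]].
  have r1 := rot _ _ _ cS dS e.
  by move=> x y /r1/r1; rewrite -!addrA.
have [/existsP[c /existsP[d /and3P[cS dS /eqP e]]]|no2] :=
    boolP [exists c, exists d, [&& c \in S, d \in S & c == d + 2]].
  exact: rot cS dS e.
have d01 : S :&: T 1 = finset.set0.
  apply/setP => x; rewrite finset.in_setI finset.in_set0.
  apply/negP => /andP[xS /imsetP[y yS e]].
  by case/existsP: no1; exists x; apply/existsP; exists y; rewrite xS yS e eqxx.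
have d02 : (S :|: T 1) :&: T 2 = finset.set0.
  apply/setP => x; rewrite finset.in_setI finset.in_set0 finset.in_setU.
  apply/negP => /andP[+ /imsetP[y yS e]].
  case/orP => [xS|/imsetP[z zS e']].
    by case/existsP: no2; exists x; apply/existsP; exists y; rewrite xS yS e eqxx.
  case/existsP: no1; exists z; apply/existsP; exists y; rewrite zS yS /=.
  by rewrite -(inj_eq (addIr 1)) -e' e -addrA.
(* Three disjoint sets of at least [m] elements cannot fit in [2 * m] residues, as [m > 0]. *)
have : (#|S :|: T 1%R :|: T 2%R| <= n.+2)%N.
  by rewrite -[X in (_ <= X)%N]card_ord max_card.
rewrite cardsU d02 cards0 subn0 cardsU d01 cards0 subn0 !TE.
by move: nE mS; set k := #|S|; lia.
Qed.

(** * Rotation by 2 acting on positions along the polygon *)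

(** An injective walk with unit steps cannot turn back, since [f (i + 1 + 1) = f i] would give
    [2 = 0] modulo [n.+3]; the first step thus sets the direction for good. *)
Lemma unit_step_map (n : nat) (f : 'I_n.+3 -> 'I_n.+3) :
  injective f -> (forall i, f (i + 1) = f i + 1 \/ f (i + 1) = f i - 1) ->
  (forall i, f i = f 0 + i) \/ (forall i, f i = f 0 - i).
Proof.
move=> finj step.
have no_back i : f (i + 1 + 1) <> f i.
  move/finj/eqP; rewrite -addrA addrC -[X in _ == X]add0r (inj_eq (addIr i)).
  by rewrite [_ + _](_ : _ = 2%:R)// natZp_eq0.
have run e : (f 1 = f 0 + e) -> (e = 1 \/ e = -1) -> forall i, f i = f 0 + e * i.
  move=> f1 e1.
  have stepe (k : nat) : f (k%:R + 1) = f k%:R + e.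
    elim: k => [|k IH]; first by rewrite add0r.
    rewrite -natr1; have := no_back k%:R; have := step (k%:R + 1).
    by rewrite IH; case: e1 => ->; rewrite ?addrK ?subrK; case.
  have fk (k : nat) : f k%:R = f 0 + e * k%:R.
    elim: k => [|k IH]; first by rewrite mulr0 addr0.
    by rewrite -natr1 stepe IH mulrDr mulr1 addrA.
  by move=> i; rewrite -(natr_Zp i).
case: (step 0); rewrite add0r => f1; [left|right] => i.
  by rewrite -[X in _ + X]mul1r; apply: run => //; left.
by rewrite -mulN1r; apply: run => //; right.
Qed.

Lemma side_periodic (n m : nat) (s : {perm 'I_n.+2}) :
  n.+2 = (2 * m)%N -> (2 < m)%N -> preserves s (fun x => x + 2) ->
  forall i, s (i + 2 + 1) - s (i + 2) = s (i + 1) - s i.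
Proof.
case: n s => [|n] s nE m2 pres; first by lia.
(* [f] is the rotation by 2 transported from vertices to positions; it sends neighbours to
   neighbours. *)
pose f i := s^-1%g (s i + 2).
have sf i : s (f i) = s i + 2 by rewrite permKV.
have finj : injective f.
  by move=> i j /(congr1 s); rewrite !sf => /addIr /perm_inj.
have step i : f (i + 1) = f i + 1 \/ f (i + 1) = f i - 1.
  have := pres _ _ (adjacent_next s i); rewrite -!sf adjacentE.
  by case/orP => /eqP ->; [left|right; rewrite addrK].
have two_ne0 k : (0 < k < n.+3)%N -> k%:R != 0 :> 'I_n.+3.
  by move=> hk; rewrite natZp_eq0; apply/negP => /dvdn_leq; lia.
(* In the reversing case [f (f 0) = 0], so turning twice by 2 fixes [s 0] and [4 = 0] modulo
   [n.+3 >= 6], which is absurd. *)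
have [fE i|fE] := unit_step_map finj step; last first.
  have /eqP : s 0 + 4 = s 0.
    have ff0 : f (f 0) = 0 by rewrite fE subrr.
    by rewrite -[in RHS]ff0 !sf -addrA -natrD.
  rewrite -[X in _ == X]addr0 (inj_eq (addrI _)) => h.
  by have := two_ne0 4%N; rewrite h; lia.
set t := f 0 in fE.
have st (k : nat) j : s (j + t *+ k) = s j + (2 * k)%:R.
  elim: k j => [|k IH] j; first by rewrite mulr0n muln0 !addr0.
  by rewrite mulrSr addrA [_ + t]addrC -fE sf IH -addrA -natrD mulnS [(2 + _)%N]addnC.
have t_gt0 : (0 < t)%N.
  rewrite lt0n; apply/eqP => t0; have t0' : t = 0 by exact: val_inj.
  have := sf 0; rewrite -/t t0' => /eqP.
  rewrite -[X in X == _]addr0 (inj_eq (addrI _)) eq_sym => h.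
  by have := two_ne0 2%N; rewrite h; lia.
(* Bezout: [km] steps of length [t] amount to one step of length [g]. *)
have [km kn bez _] := egcdnP n.+3 t_gt0; set g := gcdn t n.+3 in bez.
have natt (k : nat) : t *+ k = (t * k)%:R by rewrite natrM natr_Zp mulr_natr.
have tg : t *+ km = g%:R.
  rewrite natt mulnC bez natrD natrM.
  by have /eqP -> : n.+3%:R == 0 :> 'I_n.+3; rewrite ?natZp_eq0// mulr0 add0r.
have [q Nq] : exists q, n.+3 = (q * g)%N by apply/dvdnP; exact: dvdn_gcdr.
have [r tr] : exists r, (t : nat) = (r * g)%N by apply/dvdnP; exact: dvdn_gcdl.
have tq : t *+ q = 0.
  apply/eqP; rewrite natt natZp_eq0 tr -mulnA [(g * q)%N]mulnC -Nq.
  exact: dvdn_mull.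
(* [q] steps of length [t] return to the start while adding [2 * q] to the vertex; hence [q * g]
   divides [2 * q]. *)
have /dvdnP[l gl] : (g %| 2)%N.
  have : (n.+3 %| 2 * q)%N.
    rewrite -natZp_eq0; apply/eqP/(addrI (s 0)).
    by rewrite -st tq !addr0.
  by rewrite Nq mulnC dvdn_pmul2r//; lia.
(* Now 2 is a multiple of [t], and shifting positions by such a multiple adds the same constant to
   both ends of a side. *)
have -> : 2 = t *+ (km * l) :> 'I_n.+3.
  by rewrite mulrnA tg -mulrnA mulnC -gl.
by rewrite addrAC !st opprD addrACA subrr addr0.
Qed.

(** Constant sides make adjacency the relation [y = x + a] or [x = y + a]; each [c - x] exchanges
    the two cases. *)
Lemma reflections_regular (n : nat) (s : {perm 'I_n.+2}) (a : 'I_n.+2) :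
  (forall i, s (i + 1) - s i = a) -> forall c, c \in reflections s.
Proof.
move=> sa c; have next i : s (i + 1) = s i + a.
  by rewrite -(sa i) [RHS]addrC subrK.
have adjE x y : adjacent s x y = (y == x + a) || (x == y + a).
  by rewrite /adjacent !next !permKV.
apply/reflectionsP => x y; rewrite !adjE.
by case/orP => /eqP ->; rewrite opprD addrA subrK eqxx ?orbT.
Qed.

(** * Alternating sequences of sides *)

(** Only the parity [d] of a cyclic rotation matters: the length is even, so wrapping around
    respects the parity of indices. *)
Lemma sidesP (n m a b : nat) (s : {perm 'I_n.+2}) : n.+2 = (2 * m)%N ->
  alternating_sides s m a b <->
  exists d : bool, forall i : 'I_n.+2, side s i = if odd i (+) d then b else a.
Proof.
move=> nE.
have size_alt : size (Defs.alternating m a b) = n.+2.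
  by rewrite /Defs.alternating size_flatten /shape map_nseq sumn_nseq nE.
have nth_alt k : (k < n.+2)%N ->
    nth 0%N (Defs.alternating m a b) k = if odd k then b else a.
  rewrite nE /Defs.alternating; elim: m k {nE size_alt} => [|l IH] [|[|k]]//= kl.
  by rewrite IH ?negbK//; lia.
have nth_side (i : 'I_n.+2) : nth 0%N (sides s) i = side s i.
  by rewrite (nth_map i) ?size_enum_ord// nth_ord_enum.
have nth_rotk k i : (k <= n.+2)%N -> (i < n.+2)%N ->
    nth 0%N (rot k (Defs.alternating m a b)) i = if odd i (+) odd k then b else a.
  move=> kn iN; rewrite /rot nth_cat size_drop size_alt nth_drop.
  case: ltnP => ki; first by rewrite nth_alt ?oddD 1?addbC//; lia.
  have e : odd (i - (n.+2 - k)) = odd i (+) odd k.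
    by rewrite oddB// oddB// nE oddM.
  rewrite nth_take; last by lia.
  by rewrite nth_alt ?e//; lia.
split=> [[k]|[d sd]].
  have [kn|kn] := leqP k n.+2.
    by move=> e; exists (odd k) => i; rewrite -nth_side e nth_rotk.
  (* [rot] beyond the length is the identity, so here the phase is [false] whatever the parity of
     [k]. *)
  rewrite rot_oversize ?size_alt; last exact: ltnW.
  by move=> e; exists false => i; rewrite -nth_side e nth_alt// addbF.
exists (d : nat); apply: (@eq_from_nth _ 0%N).
  by rewrite size_rot size_alt size_map size_enum_ord.
rewrite size_map size_enum_ord => i iN; rewrite nth_rotk//; last by case: d {sd}.
by rewrite (nth_side (Ordinal iN)) sd /=; case: d {sd}.
Qed.

(** Once the phases are aligned, both orderings have the same successive differences, hence differ
    by a constant [c]. *)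
Lemma alternating_shift (n m a b : nat) (s t : {perm 'I_n.+2}) :
  n.+2 = (2 * m)%N -> alternating_sides s m a b -> alternating_sides t m a b ->
  exists c d : 'I_n.+2, forall i, t i = s (i + d) + c.
Proof.
move=> nE /(sidesP _ _ _ nE)[ds hs] /(sidesP _ _ _ nE)[dt ht].
(* The shift by 0 or 1 that aligns the two phases. *)
pose d : 'I_n.+2 := (ds (+) dt)%:R.
have oddd (i : 'I_n.+2) : odd (i + d)%R = odd i (+) (ds (+) dt).
  have oddm k : odd (k %% n.+2) = odd k.
    by rewrite [in RHS](divn_eq k n.+2) oddD oddM nE oddM andbF.
  by rewrite /d Zp_nat /= oddm oddD oddm oddb.
have st i : t (i + 1) - t i = s (i + d + 1) - s (i + d).
  apply: ord_inj; rewrite -!side_Zp ht hs oddd.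
  by rewrite -addbA addbAC addbb addFb addbC.
pose c := t 0 - s d; exists c, d => i; rewrite -(natr_Zp i).
elim: (nat_of_ord i) => [|k IH]; first by rewrite add0r /c addrC subrK.
have := st k%:R; rewrite natr1 [X in s X](_ : _ = k.+1%:R + d); last first.
  by rewrite addrAC natr1.
by rewrite IH => /(congr1 (+%R (s (k%:R + d) + c))); rewrite addrC subrK => ->; ring.
Qed.

(** * Axes in the plane versus reflections of residues *)

Section Axes.
Variables (R : realType) (n : nat).
Local Open Scope classical_set_scope.
Implicit Types (s : {perm 'I_n.+2}) (c x y : 'I_n.+2) (p u z : R[i]).

Notation v := (vertex R n.+2).

Lemma pair_eqP (T : Type) (a b c d : T) :
  [set a; b] = [set c; d] -> (a = c /\ b = d) \/ (a = d /\ b = c).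
Proof.
move=> e.
have : [set c; d] a by rewrite -e; left.
have : [set c; d] b by rewrite -e; right.
have : [set a; b] c by rewrite e; left.
have : [set a; b] d by rewrite e; right.
by move=> [] ? [] ? [] ? [] ?;
  first [left; split; congruence | right; split; congruence].
Qed.

Lemma polygon_adjacent s x y : polygon R s [set v x; v y] <-> adjacent s x y.
Proof.
split=> [[i _]|].
  rewrite ordS_Zp => e; case: (pair_eqP e) => -[e1 e2];
    by rewrite -(vertex_inj e1) -(vertex_inj e2) adjacentE eqxx ?orbT.
have edge x' y' : y' = s (s^-1%g x' + 1) -> polygon R s [set v x'; v y'].
  by move=> ->; exists (s^-1%g x') => //; rewrite ordS_Zp permKV.
by case/orP => /eqP; [exact: edge | rewrite setUC; exact: edge].
Qed.

Lemma polygon_edge s (e : set R[i]) :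
  polygon R s e -> exists x y, adjacent s x y /\ e = [set v x; v y].
Proof.
move=> [i _ <-]; exists (s i), (s (ordS i)); split=> //.
by rewrite ordS_Zp; exact: adjacent_next.
Qed.

Lemma map_segments_sub s (f : R[i] -> R[i]) (g : 'I_n.+2 -> 'I_n.+2) :
  (forall x, f (v x) = v (g x)) ->
  map_segments f (polygon R s) `<=` polygon R s <-> preserves s g.
Proof.
move=> fg; have fpair x y : f @` [set v x; v y] = [set v (g x); v (g y)].
  by rewrite image_setU !image_set1 !fg.
split=> [sub x y /polygon_adjacent xy|pres _ [_ /polygon_edge[x [y [xy ->]]] <-]].
  by apply/polygon_adjacent; rewrite -fpair; apply: sub; exists [set v x; v y].
by rewrite fpair; apply/polygon_adjacent; exact: pres.
Qed.

Definition vertex_reflection c z : R[i] := v c * Num.conj z.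

(** A fixed-point set needs no choice of base point and direction, unlike [line]. *)
Definition vertex_axis c : set R[i] := [set z | vertex_reflection c z = z].

Lemma vertex_reflectionE c x : vertex_reflection c (v x) = v (c - x)%R.
Proof. by rewrite vertexBz. Qed.

Lemma vertex_reflectionK c : involutive (vertex_reflection c).
Proof.
move=> z; rewrite /vertex_reflection rmorphM /= conjCK mulrA.
by rewrite vertex_conj mul1r.
Qed.

(** The half-angle point [h] lies on the axis of [c]; if also on that of [d], cancelling
    [Num.conj h] gives [v c = v d]. *)
Lemma vertex_axis_inj : injective vertex_axis.
Proof.
move=> c d e; pose h := vertex R (n.+2 + n.+2) c.
have hE : v c = h ^+ 2 by rewrite vertex_half.
have hh : h * Num.conj h = 1 by exact: vertex_conj.
have hc : vertex_axis c h.
  by rewrite /vertex_axis /= /vertex_reflection hE expr2 -mulrA hh mulr1.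
have : vertex_axis d h by rewrite -e.
rewrite /vertex_axis /= -[in RHS]hc /vertex_reflection => /mulIf.
move=> /(_ _)/vertex_inj -> //; rewrite conjC_eq0; exact: vertex_neq0.
Qed.

(** For a fixed [z] the quotient [(z - p) / u] is its own conjugate, so it is real and serves as the
    parameter on the line. *)
Lemma line_fixed p u : u != 0 -> line p u = [set z | reflection p u z = z].
Proof.
move=> u0; have cu0 : Num.conj u != 0 by rewrite conjC_eq0.
rewrite eqEsubset; split=> [_ [t _ <-]|z /= zE].
  rewrite /= /reflection [_ - p]addrC addKr.
  have -> : Num.conj (t%:C%C * u) = t%:C%C * Num.conj u.
    by rewrite rmorphM /=; congr (_ * _); rewrite conj_complex oppr0.
  by field.
have real : Num.conj ((z - p) / u) = (z - p) / u.
  rewrite rmorphM fmorphV /= -[in RHS]zE /reflection.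
  rewrite [X in _ = X / _]addrC addKr.
  by field; rewrite u0 cu0.
move: real; case E : ((z - p) / u) => [a b]; rewrite conj_complex => -[b0].
have {}b0 : b = 0 by lra.
exists a => //=; rewrite -[_%:C%C]/(Complex a 0) -b0 -E mulfVK//.
by rewrite addrC subrK.
Qed.

Lemma axis_vertex_axis s c : c \in reflections s -> axis R s (vertex_axis c).
Proof.
move=> /reflectionsP cs; pose h := vertex R (n.+2 + n.+2) c.
have h0 : h != 0 by exact: vertex_neq0.
have hh : h * Num.conj h = 1 by exact: vertex_conj.
(* As [h] has modulus 1, [h / Num.conj h] is [h ^+ 2], that is [v c]. *)
have hE z : reflection 0 h z = vertex_reflection c z.
  rewrite /reflection /vertex_reflection add0r subr0 -vertex_half -/h.
  congr (_ * _); apply: (mulIf (_ : Num.conj h != 0)); first by rewrite conjC_eq0.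
  by rewrite mulfVK ?conjC_eq0// expr2 -mulrA hh mulr1.
exists 0, h; split=> //.
  by rewrite line_fixed//; apply/seteqP; split=> z /=; rewrite hE.
have sub : map_segments (reflection 0 h) (polygon R s) `<=` polygon R s.
  apply/(map_segments_sub s (g := fun x => c - x)%R) => // x.
  by rewrite hE vertex_reflectionE.
(* The reverse inclusion follows because the reflection is its own inverse. *)
rewrite eqEsubset; split=> // e se; exists (reflection 0 h @` e).
  by apply: sub; exists e.
rewrite image_comp -[RHS]image_id; apply: eq_imagel => z _ /=.
by rewrite !hE vertex_reflectionK.
Qed.

(* A symmetry permutes the vertices, hence fixes their centroid [0]. *)
Lemma axis_sub s : axis R s `<=` vertex_axis @` [set` reflections s].
Proof.
move=> _ [p [u [u0 -> sym]]]; set f := reflection p u in sym.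
pose w := u / Num.conj u; pose q := p - w * Num.conj p.
have cu0 : Num.conj u != 0 by rewrite conjC_eq0.
have fE z : f z = w * Num.conj z + q.
  by rewrite /f /reflection /q -/w rmorphB /= mulrBr; ring.
have w0 : w != 0 by rewrite mulf_neq0 ?invr_eq0.
have finj : injective f.
  move=> z z'; rewrite !fE => /addIr/(mulfI w0).
  exact: (can_inj (@conjCK _)).
(* Each vertex ends some side, so its image ends a side of the same polygon. *)
have fv x : exists y, f (v x) == v y.
  have : polygon R s (f @` [set v x; v (s (s^-1%g x + 1))]).
    rewrite -[X in X _]sym; exists [set v x; v (s (s^-1%g x + 1))] => //.
    by apply/polygon_adjacent; rewrite /adjacent eqxx.
  move=> /polygon_edge[y [y' [_ e]]].
  have : (f @` [set v x; v (s (s^-1%g x + 1))]) (f (v x)) by exists (v x) => //; left.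
  by rewrite e => -[->|->]; [exists y|exists y'].
pose g x := xchoose (fv x).
have fg x : f (v x) = v (g x) by apply/eqP; exact: (xchooseP (fv x)).
have ginj : injective g.
  by move=> x y e; apply/(@vertex_inj R)/finj; rewrite !fg e.
(* The images of the vertices sum to 0 by permutation, and to [n.+2] copies of [q] by the formula
   for [f]. *)
have q0 : q = 0.
  have : \sum_(x < n.+2) f (v x) = 0.
    under eq_bigr do rewrite fg.
    by rewrite -[RHS](vertex_sum0 R (ltn0Sn n : 1 < n.+2)%N) [RHS](reindex_inj ginj).
  under eq_bigr do rewrite fE.
  rewrite big_split /= -mulr_sumr -rmorph_sum /= vertex_sum0// rmorph0 mulr0 add0r.
  by rewrite sumr_const card_ord => /eqP; rewrite mulrn_eq0 => /eqP.
pose c := g 0.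
(* [w] is the image of 1, which is the vertex of index 0. *)
have wc : w = v c by rewrite -fg fE q0 addr0 vertex0 rmorph1 mulr1.
have fc z : f z = vertex_reflection c z by rewrite fE q0 addr0 wc.
exists c.
  apply/reflectionsP/(map_segments_sub s (f := f)); last by rewrite sym.
  by move=> x; rewrite fc vertex_reflectionE.
by rewrite line_fixed//; apply/seteqP; split=> z /=; rewrite -/f fc.
Qed.

Lemma card_reflections_ge s (m : nat) :
  has_axes R s m -> (m <= #|reflections s|)%N.
Proof.
move=> ax; rewrite -card_le_II -(card_le_eql ax).
apply: card_le_trans (subset_card_le (@axis_sub s)) _.
apply: card_le_trans (card_image_le _ _) _.
(* Enumerating the finite set presents it as an image of an initial segment of the naturals. *)
apply: card_le_trans _ (card_image_le (nth 0 (enum (reflections s))) _).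
apply: subset_card_le => c /= cs; exists (index c (enum (reflections s))).
  by rewrite /= cardE index_mem mem_enum.
by rewrite nth_index// mem_enum.
Qed.

(** All the [vertex_axis c] are then axes, and they are distinct. This serves to exclude constant
    sides. *)
Lemma has_axes_ge s (m : nat) :
  (forall c, c \in reflections s) -> has_axes R s m -> (n.+2 <= m)%N.
Proof.
move=> all_refl ax; rewrite -card_le_II -(card_le_eqr ax).
rewrite (card_le_eql (@card_II n.+2)).
rewrite -(card_le_eql (inj_card_eq (in2W vertex_axis_inj))).
by apply: subset_card_le => _ [c _ <-]; exact: axis_vertex_axis.
Qed.

(** The shift [d] merely reindexes the segments, while adding [c] to indices multiplies vertices by
    [v c]. *)
Lemma polygon_rotation s (t : {perm 'I_n.+2}) c (d : 'I_n.+2) :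
  (forall i, t i = s (i + d) + c) ->
  polygon R t = map_segments ( *%R (v c)) (polygon R s).
Proof.
move=> st.
have edge i : [set v (t i); v (t (ordS i))] =
    *%R (v c) @` [set v (s (i + d)%R); v (s (ordS (i + d)%R))].
  rewrite image_setU !image_set1 -!vertexDz !ordS_Zp !st.
  by rewrite ![(c + _)%R]addrC addrAC.
rewrite eqEsubset; split=> [_ [i _ <-]|_ [_ [i _ <-] <-]].
  rewrite edge; exists [set v (s (i + d)%R); v (s (ordS (i + d)%R))] => //.
  by exists (i + d)%R.
by exists (i - d)%R => //; rewrite edge subrK.
Qed.

End Axes.

Theorem theorem1 (R : realType) (n m : nat)
  (hn : n = (2 * m)%N) (hn3 : (3 < n)%N) (hn4 : n <> 4%N)
  (sigma : {perm 'I_n}) (hsigma : has_axes R sigma m) :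
  exists a b : nat,
    [/\ (1 <= a)%N /\ (a < b)%N /\ (b <= n - 1)%N,
        alternating_sides sigma m a b
      & forall tau : {perm 'I_n}, alternating_sides tau m a b ->
          exists w : R[i], `|w| = 1 /\
            polygon R tau = map_segments ( *%R w) (polygon R sigma)].
Proof.
case: n hn hn3 hn4 sigma hsigma => [|[|n]]// hn hn3 hn4 s ax.
have m3 : (2 < m)%N by lia.
have per := side_periodic hn m3 (preserves_add2 hn (card_reflections_ge ax)).
have sE (i : 'I_n.+2) : side s i = if odd i then side s 1 else side s 0.
  (* The induction carries two consecutive sides, since the period is 2. *)
  have h (k : nat) : side s k%:R = (if odd k then side s 1 else side s 0) /\
      side s k.+1%:R = (if odd k then side s 0 else side s 1).
    elim: k => [//|k [IH IH']] /=; split; first by rewrite IH' if_neg.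
    rewrite [side _ _]side_Zp (_ : k.+2%:R = k%:R + 2) ?per -?side_Zp ?IH ?if_neg//.
    by rewrite -natrD addn2.
  by rewrite -{1}(natr_Zp i) (h i).1.
have side_gt0 i : (0 < side s i)%N.
  rewrite lt0n side_Zp; apply/eqP => e.
  have /eqP : s (i + 1) - s i = 0 by exact: val_inj.
  rewrite subr_eq0 (inj_eq perm_inj) -[X in _ == X]addr0 (inj_eq (addrI i)).
  by rewrite oner_eq0.
have side_le i : (side s i <= n.+2 - 1)%N by rewrite side_Zp subn1 -ltnS ltn_ord.
(* Equal sides would make every residue a reflection and give at least [2 * m] axes. *)
have ne : side s 0 != side s 1.
  apply/eqP => e; suff : (n.+2 <= m)%N by lia.
  apply: has_axes_ge ax; apply: reflections_regular (s 1 - s 0) _ => i.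
  apply: ord_inj; rewrite -[1 in RHS]add0r -!side_Zp sE e.
  by case: ifP.
suff [a [b [ab alt]]] : exists a b, [&& 0 < a, a < b & b <= n.+2 - 1]%N /\
    alternating_sides s m a b.
  exists a, b; split=> //; first by case/and3P: ab.
  move=> t /(alternating_shift hn alt)[c [d st]].
  exists (vertex R n.+2 c); split; first exact: vertex_norm.
  exact: polygon_rotation st.
(* The smaller side is named [a]; when it sits at odd positions the sequence has phase [true]. *)
case: (ltngtP (side s 0) (side s 1)) ne => // lt01 _.
  exists (side s 0), (side s 1); split; first by rewrite side_gt0 lt01 side_le.
  by apply/(sidesP _ _ _ hn); exists false => i; rewrite addbF.
exists (side s 1), (side s 0); split; first by rewrite side_gt0 lt01 side_le.
by apply/(sidesP _ _ _ hn); exists true => i; rewrite addbT if_neg.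
Qed.
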